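(* Let $n,k\in\mathbb{N}$ with $n\ge 3k-1$. If for all $t$ with $2\le t\le k$ the inequality \[ k^t\binom{n-t}{k-t}+t\le \binom{n-1}{k-1} \] holds, then \[ \mathrm{gp}(K(n,k))=\binom{n-1}{k-1}, \] where $K(n,k)$ is the Kneser graph.
   Context: Graphs are finite, undirected and simple. For positive integers $n\ge k$, the Kneser graph $K(n,k)$ has as vertices all $k$-element subsets of $[n]=\{1,\ldots,n\}$, two vertices being adjacent if the corresponding sets are disjoint. For a graph $G$, $d_G$ is the shortest-path distance; a $u,v$-geodesic is a $u,v$-path of length $d_G(u,v)$. A set $S\subseteq V(G)$ is a general position set of $G$ if no vertex of $S$ lies on a geodesic between two other vertices of $S$. The general position number $\mathrm{gp}(G)$ is the maximum cardinality of a general position set of $G$.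
   Formalization: The formal theorem assumes k ≥ 2; for k = 1 the condition on t is vacuous and the claim fails for every n ≥ 2, since K(n,1) is the complete graph with gp = n while binom(n-1,0) = 1. *)

(* Defs.v *)
From mathcomp Require Import all_boot.

Set Implicit Arguments.
Unset Strict Implicit.
Unset Printing Implicit Defensive.

Record sgraph := SGraph {
  vertex :> finType;
  adj : rel vertex;
  adj_sym : symmetric adj;
  adj_irrefl : irreflexive adj }.

(* As in path.v, a path starting at u is represented by u and the sequence p
   of the vertices that follow u, so its length (number of edges) is size p. *)
Definition is_path (G : sgraph) (u v : G) (p : seq G) : bool :=
  [&& path (@adj G) u p, last u p == v & uniq (u :: p)].

(* A path has fewer than #|G| edges, so the search covers all lengths; the
   value is #|G| when there is no path between u and v. *)
Definition dist (G : sgraph) (u v : G) : nat :=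
  find (fun m => [exists p : m.-tuple G, is_path u v p]) (iota 0 #|G|).

Definition geodesic (G : sgraph) (u v : G) (p : seq G) : bool :=
  is_path u v p && (size p == dist u v).

Definition on_geodesic (G : sgraph) (u v x : G) : bool :=
  [exists p : (dist u v).-tuple G, geodesic u v p && (x \in u :: p)].

Definition general_position (G : sgraph) (S : {set G}) : bool :=
  [forall x in S, forall u in S, forall v in S,
    [&& x != u, x != v & u != v] ==> ~~ on_geodesic u v x].

Definition gp (G : sgraph) : nat :=
  \max_(S : {set G} | general_position S) #|S|.

Definition ksubset (n k : nat) : finType := {A : {set 'I_n} | #|A| == k}.

(* For k > 0 the condition A != B follows from disjointness; it only rules out
   the loop at the empty set when k = 0. *)
Definition kneser_adj (n k : nat) : rel (ksubset n k) :=
  fun A B => (A != B) && [disjoint val A & val B].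

Lemma kneser_adj_sym n k : symmetric (@kneser_adj n k).
Proof. by move=> A B; rewrite /kneser_adj eq_sym disjoint_sym. Qed.

Lemma kneser_adj_irrefl n k : irreflexive (@kneser_adj n k).
Proof. by move=> A; rewrite /kneser_adj eqxx. Qed.

Definition kneser (n k : nat) : sgraph :=
  SGraph (@kneser_adj_sym n k) (@kneser_adj_irrefl n k).

(* Main.v *)
(* Since n >= 3k - 1, the Kneser graph has diameter 2, so a set in general
   position induces no path on three vertices: it is a disjoint union of cliques.
   If one of them is a clique C of size t >= 2, all other members meet the t
   pairwise disjoint sets in C, hence contain a transversal of them: there are at
   most k^t binom(n-t, k-t) such members if t <= k, and none if t > k.  Otherwise
   the family is intersecting: it is a star or, by a covering argument, it has at
   most k^2 binom(n-2, k-2) members, so the bound for t = 2 replaces the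
   Erdos-Ko-Rado theorem. *)
Require Import Defs.
From mathcomp Require Import all_boot.
From mathcomp Require Import zify.

Set Implicit Arguments.
Unset Strict Implicit.
Unset Printing Implicit Defensive.

(** * Distances and short geodesics *)

Lemma is_path_size_lt (G : sgraph) (u v : G) (p : seq G) :
  is_path u v p -> size p < #|G|.
Proof.
case/and3P=> _ _ /card_uniqP; rewrite /= => <-; exact: max_card.
Qed.

Lemma dist_leq (G : sgraph) (u v : G) (p : seq G) :
  is_path u v p -> dist u v <= size p.
Proof.
move=> up; rewrite leqNgt; apply/negP=> /(before_find 0).
rewrite nth_iota ?(is_path_size_lt up) // add0n.
by case/existsP; exists (in_tuple p).
Qed.

(** The given path is shorter than [#|G|], so the search defining [dist] succeeds and does not
    return its default value. *)
Lemma dist_realized (G : sgraph) (u v : G) (p : seq G) :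
  is_path u v p -> exists2 q, is_path u v q & size q = dist u v.
Proof.
move=> up; have ltp := is_path_size_lt up.
have ltd : dist u v < #|G| by exact: leq_ltn_trans (dist_leq up) ltp.
have /(nth_find 0) : has (fun m => [exists q : m.-tuple G, is_path u v q])
    (iota 0 #|G|) by rewrite has_find size_iota.
rewrite -/(dist u v) nth_iota // add0n => /existsP[q uq].
by exists q; rewrite ?size_tuple.
Qed.

Lemma on_geodesic_midpoint (G : sgraph) (u v x : G) :
  adj u x -> adj x v -> u != v -> ~~ adj u v -> on_geodesic u v x.
Proof.
move=> ux xv uv nuv.
have up : is_path u v [:: x; v].
  rewrite /is_path /= ux xv eqxx !inE negb_or uv !andbT /=.
  apply/andP; split; last by apply/eqP=> e; move: xv; rewrite e adj_irrefl.
  by apply/eqP=> e; move: ux; rewrite e adj_irrefl.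
have dE : size [:: x; v] == dist u v.
  rewrite eqn_leq dist_leq // andbT.
  (* A shortest path of length 0 or 1 would make [u] and [v] equal or adjacent. *)
  have [[|y [|z q]] uq <- //=] := dist_realized up.
    by move: uq; rewrite /is_path /= (negPf uv).
  by case/and3P: uq; rewrite /= andbT => uy /eqP yv; rewrite -yv uy in nuv.
apply/existsP; exists (Tuple dE).
by rewrite /geodesic up dE !inE eqxx orbT.
Qed.

Lemma on_geodesic_dist_leq2 (G : sgraph) (u v x : G) :
  dist u v <= 2 -> x != u -> x != v -> on_geodesic u v x -> adj u x.
Proof.
move=> d2 xu xv /existsP[[p /= _] /andP[/andP[/and3P[pp /eqP lp _] /eqP sp]]].
rewrite -sp in d2; rewrite inE (negPf xu) /=.
case: p pp lp d2 {sp} => [|y [|z [|]]] //=; rewrite !inE.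
  by move=> _ ->; rewrite (negPf xv).
by case/and3P=> uy _ _ -> _; rewrite (negPf xv) orbF => /eqP->.
Qed.

(** * General position, independence and cliques *)

Definition independent (G : sgraph) (S : {set G}) : bool :=
  [forall x in S, forall y in S, ~~ adj x y].

Definition clique (G : sgraph) (S : {set G}) : bool :=
  [forall x in S, forall y in S, (x != y) ==> adj x y].

Lemma independentP (G : sgraph) (S : {set G}) :
  reflect {in S &, forall x y, ~~ adj x y} (independent S).
Proof.
apply: (iffP forall_inP) => [H x y xS yS | H x xS].
  by move/forall_inP: (H x xS); apply.
by apply/forall_inP=> y; apply: H.
Qed.

Lemma cliqueP (G : sgraph) (S : {set G}) :
  reflect {in S &, forall x y, x != y -> adj x y} (clique S).
Proof.
apply: (iffP forall_inP) => [H x y xS yS | H x xS].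
  by move/forall_inP: (H x xS) => /(_ y yS)/implyP.
by apply/forall_inP=> y yS; apply/implyP; apply: H.
Qed.

(** In diameter at most two, an inner vertex of a geodesic is adjacent to its ends, which
    independence forbids. *)
Lemma independent_general_position (G : sgraph) (S : {set G}) :
  (forall u v : G, dist u v <= 2) -> independent S -> general_position S.
Proof.
move=> diam2 /independentP indS.
apply/forall_inP=> x xS; apply/forall_inP=> u uS; apply/forall_inP=> v vS.
apply/implyP=> /and3P[xu xv _]; apply/negP=> /on_geodesic_dist_leq2.
by move/(_ (diam2 _ _) xu xv); apply/negP/indS.
Qed.

(** Otherwise [x] would be the midpoint of a geodesic from [u] to [v]. *)
Lemma general_position_adj_trans (G : sgraph) (S : {set G}) (u x v : G) :
  general_position S -> u \in S -> x \in S -> v \in S ->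
  u != v -> adj u x -> adj x v -> adj u v.
Proof.
move=> gpS uS xS vS uv ux xv; apply/contraT=> nuv.
move/forall_inP: gpS => /(_ x xS)/forall_inP/(_ u uS)/forall_inP/(_ v vS).
rewrite on_geodesic_midpoint // uv andbT implybF negb_and !negbK.
by case/orP=> /eqP e; [move: ux | move: xv]; rewrite e adj_irrefl.
Qed.

(* [C] is a connected component of the subgraph induced by [S]. *)
Lemma general_position_component (G : sgraph) (S : {set G}) :
  general_position S ->
  independent S \/
  exists C : {set G}, [/\ C \subset S, clique C, 1 < #|C| &
    {in S :\: C & C, forall x c, ~~ adj c x}].
Proof.
move=> gpS; case: (boolP (independent S)) => [|nind]; [by left | right].
move: nind; rewrite negb_forall_in => /exists_inP[u uS].
rewrite negb_forall_in => /exists_inP[v vS]; rewrite negbK => uv.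
have u_neq_v : u != v by apply/eqP=> e; rewrite e adj_irrefl in uv.
pose P (C : {set G}) := (C \subset S) && clique C.
have P2 : P [set u; v].
  rewrite /P subUset !sub1set uS vS /=; apply/cliqueP=> x y.
  by rewrite !inE => /orP[]/eqP-> /orP[]/eqP->; rewrite ?eqxx // adj_sym.
(* Extend the edge [uv] to a maximal clique in [S]. By transitivity, a further vertex of [S]
   adjacent to one member is adjacent to all and could be added. *)
have [C /maxsetP[/andP[CS clC] maxC] uvC] := maxset_exists P2.
exists C; split=> //.
  by apply: leq_trans (subset_leq_card uvC); rewrite cards2 u_neq_v.
move=> x c; rewrite inE => /andP[xC xS] cC; apply/negP=> cx.
have adjx : {in C, forall d, adj d x}.
  move=> d dC; case: (eqVneq d c) => [-> //|dc].
  apply: (general_position_adj_trans (x := c) gpS) => //.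
  - exact: (subsetP CS).
  - exact: (subsetP CS).
  - by apply/eqP=> e; rewrite -e dC in xC.
  - exact: (cliqueP _ clC).
have : x |: C = C.
  apply: maxC (subsetUr _ _); rewrite /P subUset sub1set xS CS /=.
  apply/cliqueP=> y z; rewrite !inE => /orP[/eqP->|yC] /orP[/eqP->|zC].
  - by rewrite eqxx.
  - by rewrite adj_sym adjx.
  - by rewrite adjx.
  - exact: (cliqueP _ clC).
by move/setP/(_ x); rewrite !inE eqxx (negPf xC).
Qed.

(** * Counting in families of finite sets *)

Lemma leq_binomial (m j : nat) : 0 < j < m -> m <= 'C(m, j).
Proof.
elim: m j => [|m IHm] [|j] // /andP[_ ltjm]; rewrite binS.
case: (ltngtP j.+1 m) => [lt|gt|e].
- have := IHm j.+1; rewrite lt => /(_ isT).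
  have : 0 < 'C(m, j) by rewrite bin_gt0; lia.
  lia.
- lia.
- by rewrite e binn -e binSn.
Qed.

Lemma disjoint_witness (T : finType) (A B : {set T}) :
  ~~ [disjoint A & B] -> exists2 a, a \in A & a \in B.
Proof.
by rewrite -setI_eq0 => /set0Pn[a]; rewrite inE => /andP[]; exists a.
Qed.

Lemma leq_card_bigcup (I T : finType) (A : {set I}) (F : I -> {set T}) (m : nat) :
  {in A, forall i, #|F i| <= m} -> #|\bigcup_(i in A) F i| <= #|A| * m.
Proof.
move=> le_m; rewrite -sum_nat_const.
apply: (@leq_trans (\sum_(i in A) #|F i|)); last exact: leq_sum.
elim/big_rec2: _ => [|i s X _ le]; first by rewrite cards0.
by apply: leq_trans (leq_card_setU _ _) _; rewrite leq_add2l.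
Qed.

(** Removing [B] is a bijection onto the subsets of its complement with [k - #|B|] elements. *)
Lemma card_supersets (T : finType) (k : nat) (B : {set T}) : #|B| <= k ->
  #|[set X : {set T} | (#|X| == k) && (B \subset X)]| =
  'C(#|T| - #|B|, k - #|B|).
Proof.
move=> Bk; rewrite -cardsT -(cardsDS (subsetT B)) setTD.
rewrite -(cards_draws (~: B) (k - #|B|)).
rewrite -[in RHS](card_in_imset (f := fun Y => B :|: Y)); last first.
  move=> Y Z; rewrite !inE => /andP[YB _] /andP[ZB _] e.
  have H (W : {set T}) : W \subset ~: B -> (B :|: W) :\: B = W.
    rewrite setDUl setDv set0U => WB; apply/setDidPl.
    by rewrite disjoints_subset.
  by rewrite -(H Y) // e H.
apply: eq_card => X; rewrite inE; apply/andP/imsetP=> [[/eqP Xk BX]|[Y]].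
  exists (X :\: B); last by rewrite -{1}(setIidPr BX) setID.
  by rewrite inE setDE subsetIr -setDE cardsDS // Xk eqxx.
rewrite inE => /andP[YB /eqP cY] ->; rewrite subsetUl cardsU cY; split=> //.
suff -> : B :&: Y = set0 by rewrite cards0; lia.
by apply/eqP; rewrite setI_eq0 disjoint_sym disjoints_subset.
Qed.

(* A [k]-set containing [B] and meeting every member of [l] contains [B] together
   with one of the at most [k ^ size l] transversals of [l].  When these have
   more than [k] elements there is no such set, and the truncated binomial
   coefficient on the right is [1]. *)
Lemma card_transversal_supersets (T : finType) (k : nat) (l : seq {set T})
    (B : {set T}) :
  pairwise (fun X Y : {set T} => [disjoint X & Y]) l ->
  all (fun X : {set T} => (#|X| <= k) && [disjoint B & X]) l ->
  #|[set X : {set T} | [&& #|X| == k, B \subset X &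
       all (fun Y : {set T} => ~~ [disjoint Y & X]) l]]| <=
  k ^ size l * 'C(#|T| - (#|B| + size l), k - (#|B| + size l)).
Proof.
elim: l B => [|A l IHl] B /=.
  move=> _ _; rewrite expn0 mul1n addn0.
  case: (leqP #|B| k) => Bk.
    rewrite -card_supersets //; apply: subset_leq_card; apply/subsetP=> X.
    by rewrite !inE andbT.
  rewrite (_ : [set _ | _] = set0) ?cards0 //; apply/setP=> X; rewrite !inE andbT.
  apply/negP=> /andP[/eqP Xk /subset_leq_card]; lia.
case/andP=> /allP Al pl /andP[/andP[Ak BA] Bl].
set m := 'C(_, _).
(* Branch on a point [a] of [A] lying in [X] and move it into the base set: the at most [k] choices
   give one factor [k]. *)
pose F a := [set X : {set T} | [&& #|X| == k, a |: B \subset X &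
       all (fun Y : {set T} => ~~ [disjoint Y & X]) l]].
apply: (@leq_trans #|\bigcup_(a in A) F a|).
  apply: subset_leq_card; apply/subsetP=> X; rewrite inE.
  case/and4P=> Xk BX /disjoint_witness[a aA aX] lX.
  apply/bigcupP; exists a => //.
  by rewrite inE Xk lX subUset sub1set aX BX.
apply: (@leq_trans (#|A| * (k ^ size l * m))); last first.
  by rewrite expnS -mulnA leq_mul2r Ak orbT.
apply: leq_card_bigcup => a aA; apply: leq_trans (IHl (a |: B) pl _) _.
  apply/allP=> Y Yl; case/andP: (allP Bl Y Yl) => -> BY /=.
  move: (Al Y Yl) BY; rewrite !disjoints_subset => AY BY.
  by rewrite subUset BY sub1set (subsetP AY).
(* The base set gains one point while the list loses one set, so the binomial coefficient [m] is
   unchanged. *)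
have aB : a \notin B.
  by apply/negP=> aB; move: BA; rewrite disjoints_subset => /subsetP/(_ a aB);
    rewrite inE aA.
by rewrite cardsU1 aB add1n addSnnS.
Qed.

Lemma card_star (T : finType) (k : nat) (x : T) : 0 < k ->
  #|[set X : {set T} | (#|X| == k) && (x \in X)]| = 'C(#|T| - 1, k - 1).
Proof.
move=> k0; rewrite -(cards1 x) -card_supersets ?cards1 //.
by apply: eq_card => X; rewrite !inE sub1set.
Qed.

(* Each point [a] of a fixed member [A] is avoided by some member [B]; the
   members containing [a] meet [B] outside [a]. *)
Lemma card_intersecting_nontrivial (T : finType) (k : nat) (F : {set {set T}}) :
  {in F, forall X : {set T}, #|X| = k} ->
  {in F &, forall X Y : {set T}, ~~ [disjoint X & Y]} ->
  (forall x, exists2 Y, Y \in F & x \notin Y) ->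
  #|F| <= k ^ 2 * 'C(#|T| - 2, k - 2).
Proof.
move=> Fk Fint Fx; case: (set_0Vmem F) => [->|[A AF]]; first by rewrite cards0.
pose Fa (a : T) := [set X in F | a \in X].
apply: (@leq_trans #|\bigcup_(a in A) Fa a|).
  apply: subset_leq_card; apply/subsetP=> X XF.
  have [a aA aX] := disjoint_witness (Fint A X AF XF).
  by apply/bigcupP; exists a => //; rewrite inE XF.
rewrite expnS expn1 -mulnA -[X in X * _](Fk A AF).
apply: leq_card_bigcup => a _; have [B BF aB] := Fx a.
(* The transversal bound for the single set [B] gives the second factor [k]; the first comes from
   the choice of [a] in [A]. *)
have := @card_transversal_supersets T k [:: B] [set a].
rewrite /= cards1 expn1 disjoints1 aB (Fk B BF) leqnn => /(_ isT isT).
apply: leq_trans; apply: subset_leq_card; apply/subsetP=> X.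
by rewrite !inE => /andP[XF aX]; rewrite (Fk X XF) eqxx sub1set aX Fint.
Qed.

Lemma card_disjoint_family (T : finType) (k : nat) (F : {set {set T}}) :
  {in F, forall X : {set T}, #|X| = k} ->
  {in F &, forall X Y : {set T}, X != Y -> [disjoint X & Y]} ->
  #|F| * k <= #|T|.
Proof.
move=> Fk Fdis; have /eqP cF : trivIset F by apply/trivIsetP.
rewrite -sum_nat_const; apply: leq_trans (max_card (cover F)); rewrite -cF.
by apply: leq_sum => X /Fk->.
Qed.

(** Sending a point of [B] to its block reaches every member of [F], since each of them meets
    [B]. *)
Lemma leq_card_disjoint_blocks (T : finType) (F : {set {set T}}) (B : {set T}) :
  {in F &, forall X Y : {set T}, X != Y -> [disjoint X & Y]} ->
  {in F, forall X : {set T}, ~~ [disjoint X & B]} -> #|F| <= #|B|.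
Proof.
move=> Fdis FB; have trivF : trivIset F by apply/trivIsetP.
apply: leq_trans (leq_imset_card (pblock F) B).
apply: subset_leq_card; apply/subsetP=> X XF.
have [b bX bB] := disjoint_witness (FB X XF).
by apply/imsetP; exists b; rewrite ?(def_pblock trivF XF bX).
Qed.

(** This is the transversal bound with empty base set, applied to the members of [C]. *)
Lemma card_crossing_family (T : finType) (k : nat) (C F : {set {set T}}) :
  {in C, forall X : {set T}, #|X| = k} ->
  {in F, forall X : {set T}, #|X| = k} ->
  {in C &, forall X Y : {set T}, X != Y -> [disjoint X & Y]} ->
  {in F & C, forall X Y : {set T}, ~~ [disjoint X & Y]} ->
  #|F| <= k ^ #|C| * 'C(#|T| - #|C|, k - #|C|).
Proof.
move=> Ck Fk Cdis FC.
have := @card_transversal_supersets T k (enum C) set0.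
rewrite cards0 add0n -cardE => H; apply: leq_trans (H _ _).
- apply: subset_leq_card; apply/subsetP=> X XF; rewrite inE (Fk X XF) eqxx sub0set.
  by apply/allP=> Y; rewrite mem_enum disjoint_sym => YC; apply: FC.
- apply: (@sub_in_pairwise _ (mem C) (fun X Y => X != Y)).
  + by move=> X Y; apply: Cdis.
  + by apply/allP=> X; rewrite mem_enum.
  + by have := enum_uniq C; rewrite uniq_pairwise.
- apply/allP=> X; rewrite mem_enum => /Ck->.
  by rewrite leqnn -setI_eq0 set0I eqxx.
Qed.

(** * Kneser graphs *)

Lemma kneser_nadj (n k : nat) (A B : kneser n k) : 0 < k ->
  ~~ adj A B = ~~ [disjoint val A & val B].
Proof.
move=> k0; rewrite /= /kneser_adj; case: eqVneq => [->|//] /=.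
by rewrite -setI_eq0 setIid -cards_eq0 (eqP (valP B)) -lt0n k0.
Qed.

Lemma kneser_diameter (n k : nat) (A B : kneser n k) :
  2 <= k -> 3 * k - 1 <= n -> dist A B <= 2.
Proof.
move=> k2 n_ge; have k0 : 0 < k by lia.
have self_nadj X : ~~ @adj (kneser n k) X X by rewrite adj_irrefl.
case: (eqVneq A B) => [->|neq].
  by apply: (@leq_trans (size ([::] : seq (kneser n k)))) => //;
    apply: dist_leq; rewrite /is_path /= eqxx.
case: (boolP (@adj (kneser n k) A B)) => [AB|nAB].
  apply: (@leq_trans (size ([:: B] : seq (kneser n k)))) => //.
  by apply: dist_leq; rewrite /is_path /= inE neq eqxx !andbT.
(* Non-adjacent sets meet, so their union has at most [2 * k - 1] points and leaves room for a
   common neighbour. *)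
have cU : k <= #|~: (val A :|: val B)|.
  have := cardsC (val A :|: val B); rewrite cardsU card_ord.
  rewrite (eqP (valP A)) (eqP (valP B)).
  move: nAB; rewrite kneser_nadj // -setI_eq0 -card_gt0; lia.
have [D DU Dk] : exists2 D : {set 'I_n}, D \subset ~: (val A :|: val B) & #|D| == k.
  have : 0 < #|[set D : {set 'I_n} | (D \subset ~: (val A :|: val B)) && (#|D| == k)]|.
    by rewrite cards_draws bin_gt0.
  by case/card_gt0P=> D; rewrite inE => /andP[]; exists D.
pose X : kneser n k := Sub D Dk.
move: DU; rewrite setCU subsetI -!disjoints_subset => /andP[DA DB].
have XA : @adj (kneser n k) A X.
  by rewrite -[adj _ _]negbK kneser_nadj // negbK disjoint_sym.
have XB : @adj (kneser n k) X B.
  by rewrite -[adj _ _]negbK kneser_nadj // negbK.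
apply: (@leq_trans (size ([:: X; B] : seq (kneser n k)))) => //.
apply: dist_leq; rewrite /is_path; apply/and3P; split.
- by move: XA XB => /= -> ->.
- by [].
- rewrite [uniq _]/= !inE negb_or neq !andbT; apply/andP; split.
  + by apply: contraTneq XA => <-.
  + by apply: contraTneq XB => ->.
Qed.

Theorem theorem2p3 (n k : nat) (k_ge2 : 2 <= k) (n_ge : 3 * k - 1 <= n)
  (binomial_bound : forall t : nat, 2 <= t <= k ->
     k ^ t * 'C(n - t, k - t) + t <= 'C(n - 1, k - 1)) :
  gp (kneser n k) = 'C(n - 1, k - 1).
Proof.
have k0 : 0 < k by lia.
have valE (F : {set kneser n k}) : #|val @: F| = #|F|.
  exact: card_imset val_inj.
have valk (F : {set kneser n k}) : {in val @: F, forall X : {set 'I_n}, #|X| = k}.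
  by move=> _ /imsetP[X _ ->]; exact: (eqP (valP X)).
have starE (x : 'I_n) : #|[set X : kneser n k | x \in val X]| = 'C(n - 1, k - 1).
  rewrite -valE -[in RHS](card_ord n) -(card_star x k0).
  apply: eq_card => X; rewrite inE; apply/imsetP/andP=> [[Y]|[Xk xX]].
    by rewrite inE => xY ->; split=> //; exact: (valP Y).
  by exists (Sub X Xk); rewrite // inE.
have n0 : 0 < n by lia.
apply/eqP; rewrite eqn_leq; apply/andP; split; last first.
  (* Lower bound: the star of the point 0 is independent. *)
  rewrite -(starE (Ordinal n0)).
  apply: (@leq_bigmax_cond _ _ (fun S : {set kneser n k} => #|S|)).
  apply: independent_general_position => [u v|]; first exact: kneser_diameter.
  apply/independentP=> A B; rewrite !inE => xA xB; rewrite kneser_nadj //.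
  by rewrite -setI_eq0; apply/set0Pn; exists (Ordinal n0); rewrite inE xA.
apply/bigmax_leqP=> S /general_position_component[/independentP indS|[C [CS clC C2 CX]]].
  case: (boolP [exists x : 'I_n, [forall X in S, x \in val X]]).
    case/existsP=> x /forall_inP xS; rewrite -(starE x).
    by apply: subset_leq_card; apply/subsetP=> X XS; rewrite inE xS.
  rewrite negb_exists => /forallP nstar.
  (* An intersecting family without a common point: the hypothesis at [t = 2] suffices, even after
     dropping its summand 2. *)
  have := binomial_bound 2; rewrite k_ge2 => /(_ isT).
  apply: leq_trans; apply: leq_trans (leq_addr _ _).
  rewrite -valE -[in leqRHS](card_ord n).
  apply: card_intersecting_nontrivial => [//||x].
    move=> _ _ /imsetP[X XS ->] /imsetP[Y YS ->].
    by rewrite -kneser_nadj //; apply: indS.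
  have := nstar x; rewrite negb_forall_in => /exists_inP[Y YS xY].
  by exists (val Y) => //; apply: imset_f.
have Cdis : {in val @: C &, forall X Y : {set 'I_n}, X != Y -> [disjoint X & Y]}.
  move=> _ _ /imsetP[X XC ->] /imsetP[Y YC ->] neq.
  rewrite -[[disjoint _ & _]]negbK -kneser_nadj // negbK.
  by apply: (cliqueP _ clC) => //; apply: contraNneq neq => ->.
have cross : {in val @: (S :\: C) & val @: C,
    forall X Y : {set 'I_n}, ~~ [disjoint X & Y]}.
  move=> _ _ /imsetP[X XS ->] /imsetP[Y YC ->].
  by rewrite disjoint_sym -kneser_nadj // CX.
have SE : #|S| = #|S :\: C| + #|C|.
  by rewrite -(cardsID C S) (setIidPr CS) addnC.
(* For [#|C| <= k], take [t = #|C|]: the product bounds [S :\: C] and the summand [t] accounts for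
   [C] itself. *)
case: (leqP #|C| k) => Ck.
  have := binomial_bound #|C|; rewrite C2 Ck => /(_ isT).
  apply: leq_trans; rewrite SE leq_add2r -valE -[in leqRHS](valE C).
  have := card_crossing_family (valk C) (valk (S :\: C)) Cdis cross.
  by rewrite card_ord.
(* A member outside [C] would meet more than [k] disjoint sets with only [k] points. *)
have -> : S = C.
  apply/eqP; rewrite eqEsubset CS andbT; apply/subsetP=> X XS.
  apply: contraLR Ck => XC; rewrite -leqNgt -valE -[leqRHS](eqP (valP X)).
  apply: (leq_card_disjoint_blocks Cdis) => _ /imsetP[Y YC ->].
  by rewrite disjoint_sym; apply: cross; apply: imset_f; rewrite // inE XC.
have := card_disjoint_family (valk C) Cdis.
rewrite valE card_ord => Ckn.
(* From [#|C| * k <= n] and [2 <= k] follows [#|C| <= n - 1], which is at most the binomial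
   coefficient. *)
have := @leq_binomial (n - 1) (k - 1); rewrite (_ : 0 < k - 1 < n - 1); last lia.
move=> /(_ isT); apply: leq_trans; nia.
Qed.
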